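(* Let $k,\rho,c,\ell,\gamma,q_0>0$ and $0<\varepsilon<1$ be real constants and let $\alpha=\frac{k}{\rho c}$. Suppose that $$q_0>q_0^*:=\sqrt{\frac{\gamma(1-\varepsilon)\rho\ell k}{2}}.$$ Then the solution $(T,s,r)$ of Problem $(P_3)$ (stated in the context) is given by $$T(x,t)=-\frac{q_0\sqrt{\pi\alpha}\,\operatorname{erf}(\omega)}{k}\left[1-\frac{\operatorname{erf}\left(\frac{x}{2\sqrt{\alpha t}}\right)}{\operatorname{erf}(\omega)}\right]<0,\quad 0<x<s(t),\ t>0,$$ $$s(t)=2\omega\sqrt{\alpha t},\qquad r(t)=2\nu\sqrt{\alpha t},\qquad t>0,$$ with $$\nu=\omega+\frac{\gamma k}{2q_0\sqrt{\alpha}}\,e^{\omega^2},$$ where the coefficient $\omega>0$ is the unique solution of the equation $$G_3(x)=\frac{q_0}{\rho\ell\sqrt{\alpha}},\quad x>0,\qquad G_3(x)=\left[x+\frac{\gamma(1-\varepsilon)k}{2q_0\sqrt{\alpha}}e^{x^2}\right]e^{x^2}.$$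
   Context: $\operatorname{erf}(x)=\frac{2}{\sqrt{\pi}}\int_0^x e^{-u^2}\,du$. Problem $(P_3)$ (one-phase solidification with a mushy zone and a heat flux boundary condition): find free boundaries $x=s(t)$, $x=r(t)$ with $s(t)<r(t)$ for $t>0$, and a temperature $T=T(x,t)$, such that - $T_t-\alpha T_{xx}=0$ for $0<x<s(t)$, $t>0$; - $T(s(t),t)=0$ for $t>0$; - $kT_x(s(t),t)=\rho\ell[\varepsilon\dot s(t)+(1-\varepsilon)\dot r(t)]$ for $t>0$; - $T_x(s(t),t)\,(r(t)-s(t))=\gamma$ for $t>0$; - $s(0)=r(0)=0$; - $kT_x(0,t)=\frac{q_0}{\sqrt t}$ for $t>0$. Values of $T$ and $T_x$ at $x=0$ and $x=s(t)$ are those of the smooth extension of $T$ up to the boundary. ''The solution is given by'' means: the equation for $\omega$ has exactly one solution $\omega>0$, and the functions $T,s,r$ defined by the formulas satisfy all the conditions of the problem. *)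

(* Defs.v *)
From Stdlib Require Import Reals.
From Coquelicot Require Import Coquelicot.
Open Scope R_scope.

(* Stdlib's concrete reals, with Coquelicot's total derivative and integral. *)

Definition erf (x : R) : R :=
  2 / sqrt PI * RInt (fun u => exp (- u ^ 2)) 0 x.

Definition dx (f : R -> R -> R) (x t : R) : R := Derive (fun y => f y t) x.
Definition dt (f : R -> R -> R) (x t : R) : R := Derive (fun tau => f x tau) t.

Fixpoint Ck (n : nat) (O : R * R -> Prop) (f : R -> R -> R) : Prop :=
  (forall x t, O (x, t) -> continuity_2d_pt f x t) /\
  match n with
  | 0%nat => True
  | S m =>
      (forall x t, O (x, t) ->
         ex_derive (fun y => f y t) x /\ ex_derive (fun tau => f x tau) t) /\
      Ck m O (dx f) /\ Ck m O (dt f)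
  end.

(* [U] extends [T] from the open region 0 < x < s(t), t > 0 to a function that
   is C^infinity on a neighbourhood of the region 0 <= x <= s(t), t > 0.
   Whenever s > 0, the values of [U] and [dx U] at x = 0 and x = s(t) are
   determined by [T], as limits from inside the open region; the values of the
   total function [T] outside that region play no role. *)
Definition smooth_extension (T : R -> R -> R) (s : R -> R) (U : R -> R -> R)
    : Prop :=
  (forall x t, 0 < t -> 0 < x < s t -> U x t = T x t) /\
  exists O : R * R -> Prop,
    open O /\
    (forall x t, 0 < t -> 0 <= x <= s t -> O (x, t)) /\
    (forall n, Ck n O U).

(* One-phase solidification with a mushy zone s(t) < x < r(t) and a prescribed
   heat flux at x = 0.  The free boundaries are required to be continuous at
   t = 0, so that s(0) = r(0) = 0 constrains their behaviour for t > 0. *)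
Record solves_P3 (alpha k rho ell eps gamma q0 : R)
    (T : R -> R -> R) (s r : R -> R) : Prop := {
  P3_order : forall t, 0 < t -> 0 < s t /\ s t < r t;
  P3_diff_fb : forall t, 0 < t -> ex_derive s t /\ ex_derive r t;
  P3_heat : forall x t, 0 < t -> 0 < x < s t ->
    ex_derive (fun tau => T x tau) t /\
    ex_derive (fun y => T y t) x /\
    ex_derive (fun y => dx T y t) x /\
    dt T x t - alpha * dx (dx T) x t = 0;
  P3_boundary : exists U, smooth_extension T s U /\
    forall t, 0 < t ->
      U (s t) t = 0 /\
      k * dx U (s t) t =
        rho * ell * (eps * Derive s t + (1 - eps) * Derive r t) /\
      dx U (s t) t * (r t - s t) = gamma /\
      k * dx U 0 t = q0 / sqrt t;
  P3_initial : s 0 = 0 /\ r 0 = 0;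
  P3_initial_cont :
    filterlim s (at_right 0) (locally (s 0)) /\
    filterlim r (at_right 0) (locally (r 0))
}.

Definition q0_star (gamma eps rho ell k : R) : R :=
  sqrt (gamma * (1 - eps) * rho * ell * k / 2).

Definition G3 (gamma eps k q0 alpha x : R) : R :=
  (x + gamma * (1 - eps) * k / (2 * q0 * sqrt alpha) * exp (x ^ 2))
  * exp (x ^ 2).

(* Main.v *)
(** In the variable [x / (2 sqrt (alpha t))] the heat equation, the flux at
    [x = 0] and both free boundary conditions become algebraic: the condition
    [T_x (r - s) = gamma] determines [nu], and the Stefan condition is then
    [G3 omega = q0 / (rho ell sqrt alpha)].  [G3] is strictly increasing with
    [G3 x > x] for [x > 0], and [q0 > q0_star] says exactly that [G3 0] lies
    below the right-hand side.  For smoothness, the real algebra generated by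
    [x], [t^(-1/2)], [erf (a x t^(-1/2))] and [exp (- (a x t^(-1/2))^2)] is
    closed under both partial derivatives. *)

Require Import Defs.
From Stdlib Require Import Reals Lra.
From Coquelicot Require Import Coquelicot.
Open Scope R_scope.

(** * The error function *)

Lemma continuous_gauss (x : R) : continuous (fun u => exp (- u ^ 2)) x.
Proof.
  apply (ex_derive_continuous (fun u => exp (- u ^ 2))); auto_derive; trivial.
Qed.

Lemma is_derive_erf (x : R) :
  is_derive erf x (2 / sqrt PI * exp (- x ^ 2)).
Proof.
  unfold erf.
  apply (is_derive_scal (fun y => RInt (fun u => exp (- u ^ 2)) 0 y)).
  apply (is_derive_RInt (fun u => exp (- u ^ 2)) _ 0).
  - apply filter_forall; intros y.
    apply (@RInt_correct R_CompleteNormedModule), ex_RInt_continuous.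
    intros z _; apply continuous_gauss.
  - apply continuous_gauss.
Qed.

Lemma sqrt_PI_pos : 0 < sqrt PI.
Proof. apply sqrt_lt_R0, PI_RGT_0. Qed.

Lemma erf_lt (x y : R) : x < y -> erf x < erf y.
Proof.
  intros Hxy.
  apply (incr_function erf m_infty p_infty
           (fun z => 2 / sqrt PI * exp (- z ^ 2))); simpl; trivial.
  - intros z _ _; apply is_derive_erf.
  - intros z _ _; apply Rmult_lt_0_compat; [|apply exp_pos].
    apply Rdiv_lt_0_compat; [lra|apply sqrt_PI_pos].
Qed.

Lemma erf_0 : erf 0 = 0.
Proof. unfold erf; rewrite RInt_point; apply Rmult_0_r. Qed.

(** * Smoothness classes on open sets *)

Lemma open_locally_2d (O : R * R -> Prop) (x t : R) :
  open O -> O (x, t) -> locally_2d (fun u v => O (u, v)) x t.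
Proof.
  intros HO Hxt; apply locally_2d_locally.
  apply (filter_imp O); [intros [u v]; trivial | exact (HO _ Hxt)].
Qed.

(** Continuity and derivatives at a point of [O] see only nearby values, and openness keeps those
    inside [O]. This allows [dx] and [dt] of a function to be replaced by closed formulas known on
    [O] alone. *)
Lemma Ck_ext (n : nat) (O : R * R -> Prop) (f g : R -> R -> R) :
  open O -> (forall x t, O (x, t) -> f x t = g x t) -> Ck n O f -> Ck n O g.
Proof.
  intros HO; revert f g; induction n as [|n IH]; intros f g Hfg Hf.
  - destruct Hf as [Hc _]; split; trivial.
    intros x t Hxt; apply (continuity_2d_pt_ext_loc f); [|now apply Hc].
    now apply (locally_2d_impl _ _ _ _ (locally_2d_forall _ x t Hfg)),
      open_locally_2d.
  - destruct Hf as [Hc [Hd [Hx Ht]]].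
    assert (Hlx : forall x t, O (x, t) -> locally x (fun y => f y t = g y t)).
    { intros x t Hxt.
      apply (filter_imp (fun y => O (y, t))); [intros y; apply Hfg|].
      now apply (locally_2d_1d_const_y (fun u v => O (u, v))), open_locally_2d. }
    assert (Hlt : forall x t, O (x, t) -> locally t (fun y => f x y = g x y)).
    { intros x t Hxt.
      apply (filter_imp (fun y => O (x, y))); [intros y; apply Hfg|].
      now apply (locally_2d_1d_const_x (fun u v => O (u, v))), open_locally_2d. }
    split; [|split; [|split]].
    + intros x t Hxt; apply (continuity_2d_pt_ext_loc f); [|now apply Hc].
      now apply (locally_2d_impl _ _ _ _ (locally_2d_forall _ x t Hfg)),
        open_locally_2d.
    + intros x t Hxt; destruct (Hd x t Hxt) as [H1 H2]; split.
      * apply (ex_derive_ext_loc (fun y => f y t)); auto.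
      * apply (ex_derive_ext_loc (fun y => f x y)); auto.
    + apply (IH (dx f)); trivial.
      intros x t Hxt; apply Derive_ext_loc; auto.
    + apply (IH (dt f)); trivial.
      intros x t Hxt; apply Derive_ext_loc; auto.
Qed.

(* Closed expressions for the algebra generated by [x], [w = / sqrt t],
   [erf (a x w)] and [exp (- (a x w)^2)]. *)
Inductive term : Type :=
| Cst (r : R) | X | W | Erf | Gauss
| Add (e1 e2 : term) | Mul (e1 e2 : term).

Fixpoint eval (a : R) (e : term) (x t : R) : R :=
  match e with
  | Cst r => r
  | X => x
  | W => / sqrt t
  | Erf => erf (a * x * / sqrt t)
  | Gauss => exp (- (a * x * / sqrt t) ^ 2)
  | Add e1 e2 => eval a e1 x t + eval a e2 x t
  | Mul e1 e2 => eval a e1 x t * eval a e2 x t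
  end.

Fixpoint term_dx (a : R) (e : term) : term :=
  match e with
  | Cst _ | W => Cst 0
  | X => Cst 1
  | Erf => Mul (Cst (2 / sqrt PI * a)) (Mul W Gauss)
  | Gauss => Mul (Cst (- 2 * a ^ 2)) (Mul (Mul X (Mul W W)) Gauss)
  | Add e1 e2 => Add (term_dx a e1) (term_dx a e2)
  | Mul e1 e2 => Add (Mul (term_dx a e1) e2) (Mul e1 (term_dx a e2))
  end.

(** Time derivatives stay in the algebra because w = [/ sqrt t] satisfies dw/dt = -w^3/2: powers of
    [W] replace every division by t. *)
Fixpoint term_dt (a : R) (e : term) : term :=
  match e with
  | Cst _ | X => Cst 0
  | W => Mul (Cst (- / 2)) (Mul W (Mul W W))
  | Erf => Mul (Cst (- / sqrt PI * a)) (Mul (Mul X (Mul W (Mul W W))) Gauss)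
  | Gauss => Mul (Cst (a ^ 2)) (Mul (Mul (Mul X X) (Mul (Mul W W) (Mul W W))) Gauss)
  | Add e1 e2 => Add (term_dt a e1) (term_dt a e2)
  | Mul e1 e2 => Add (Mul (term_dt a e1) e2) (Mul e1 (term_dt a e2))
  end.

(** * Derivatives and smoothness of terms *)

Lemma is_derive_inv_sqrt (t : R) :
  0 < t -> is_derive (fun v => / sqrt v) t (- / 2 * (/ sqrt t) ^ 3).
Proof.
  intros Ht; assert (Hs := sqrt_lt_R0 t Ht).
  auto_derive; [repeat split; lra|field; lra].
Qed.

Lemma is_derive_eval_dx (a : R) (e : term) (x t : R) :
  is_derive (fun y => eval a e y t) x (eval a (term_dx a e) x t).
Proof.
  induction e as [r| | | | |e1 IH1 e2 IH2|e1 IH1 e2 IH2]; simpl.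
  - apply (is_derive_const r).
  - apply (is_derive_id x).
  - apply (is_derive_const (/ sqrt t)).
  - evar_last.
    + apply (is_derive_comp erf (fun y => a * y * / sqrt t));
        [apply is_derive_erf|].
      instantiate (1 := a * / sqrt t); auto_derive; trivial; ring.
    + unfold scal; simpl; unfold mult; simpl; ring.
  - auto_derive; trivial; simpl; ring.
  - apply (is_derive_plus (fun y => eval a e1 y t)); trivial.
  - apply (is_derive_mult (fun y => eval a e1 y t) (fun y => eval a e2 y t));
      trivial.
    intros; apply Rmult_comm.
Qed.

Lemma is_derive_eval_dt (a : R) (e : term) (x t : R) :
  0 < t ->
  is_derive (fun tau => eval a e x tau) t (eval a (term_dt a e) x t).
Proof.
  intros Ht; assert (Hw := is_derive_inv_sqrt t Ht).
  assert (Hz : is_derive (fun v => a * x * / sqrt v) t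
                 (a * x * (- / 2 * (/ sqrt t) ^ 3))) by now apply is_derive_scal.
  assert (Hp := sqrt_PI_pos); assert (Hst := sqrt_lt_R0 t Ht).
  induction e as [r| | | | |e1 IH1 e2 IH2|e1 IH1 e2 IH2]; simpl.
  - apply (is_derive_const r).
  - apply (is_derive_const x).
  - evar_last; [exact Hw|simpl; ring].
  - evar_last.
    + apply (is_derive_comp erf (fun v => a * x * / sqrt v));
        [apply is_derive_erf|exact Hz].
    + unfold scal; simpl; unfold mult; simpl; field; lra.
  - evar_last.
    + apply (is_derive_comp (fun z => exp (- z ^ 2)) (fun v => a * x * / sqrt v));
        [|exact Hz].
      auto_derive; [trivial|reflexivity].
    + unfold scal; simpl; unfold mult; simpl; field; lra.
  - apply (is_derive_plus (fun v => eval a e1 x v)); trivial.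
  - apply (is_derive_mult (fun v => eval a e1 x v) (fun v => eval a e2 x v));
      trivial.
    intros; apply Rmult_comm.
Qed.

Lemma continuity_2d_pt_eval (a : R) (e : term) (x t : R) :
  0 < t -> continuity_2d_pt (eval a e) x t.
Proof.
  intros Ht.
  assert (Hw : continuity_2d_pt (fun _ v => / sqrt v) x t).
  { apply (continuity_1d_2d_pt_comp (fun v => / sqrt v) (fun _ v => v));
      [|apply continuity_2d_pt_id2].
    apply continuity_pt_filterlim, (ex_derive_continuous (fun v => / sqrt v)).
    eexists; now apply is_derive_inv_sqrt. }
  assert (Hz : continuity_2d_pt (fun u v => a * u * / sqrt v) x t).
  { apply continuity_2d_pt_mult; [|exact Hw].
    apply continuity_2d_pt_mult;
      [apply continuity_2d_pt_const|apply continuity_2d_pt_id1]. }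
  induction e as [r| | | | |e1 IH1 e2 IH2|e1 IH1 e2 IH2]; simpl.
  - apply continuity_2d_pt_const.
  - apply continuity_2d_pt_id1.
  - exact Hw.
  - apply (continuity_1d_2d_pt_comp erf); [|exact Hz].
    apply continuity_pt_filterlim, (ex_derive_continuous erf).
    eexists; apply is_derive_erf.
  - apply (continuity_1d_2d_pt_comp (fun z => exp (- z ^ 2))
             (fun u v => a * u * / sqrt v)); [|exact Hz].
    apply continuity_pt_filterlim, continuous_gauss.
  - now apply continuity_2d_pt_plus.
  - now apply continuity_2d_pt_mult.
Qed.

Definition half_plane (p : R * R) : Prop := 0 < snd p.

Lemma open_half_plane : open half_plane.
Proof.
  apply (open_comp snd (fun v => 0 < v)); [|apply open_gt].
  intros [u v] _; apply (@continuous_snd R_UniformSpace R_UniformSpace).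
Qed.

(** Each partial derivative of a term agrees on the half-plane with another term, so induction on
    [n], for all terms at once, gives every order of smoothness. *)
Lemma Ck_eval (a : R) (n : nat) (e : term) : Ck n half_plane (eval a e).
Proof.
  revert e; induction n as [|n IH]; intros e;
    (split; [intros x t; apply continuity_2d_pt_eval|]); trivial.
  split; [|split].
  - intros x t Ht; split; eexists;
      [apply is_derive_eval_dx|now apply is_derive_eval_dt].
  - apply (Ck_ext n _ (eval a (term_dx a e)));
      [apply open_half_plane| |apply IH].
    intros x t _; symmetry; apply is_derive_unique, is_derive_eval_dx.
  - apply (Ck_ext n _ (eval a (term_dt a e)));
      [apply open_half_plane| |apply IH].
    intros x t Ht; symmetry; now apply is_derive_unique, is_derive_eval_dt.
Qed.

(** * The equation for [omega] *)

Lemma exp_sqr_lt (x y : R) : 0 <= x < y -> exp (x ^ 2) < exp (y ^ 2).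
Proof. intros H; apply exp_increasing; nra. Qed.

Lemma mul_exp_sqr_lt (b x y : R) :
  0 < b -> 0 <= x < y ->
  (x + b * exp (x ^ 2)) * exp (x ^ 2) < (y + b * exp (y ^ 2)) * exp (y ^ 2).
Proof.
  intros Hb Hxy; assert (He := exp_sqr_lt x y Hxy).
  assert (Hp := exp_pos (x ^ 2)).
  apply Rmult_gt_0_lt_compat; try lra; nra.
Qed.

(** The intermediate value theorem applies on [0, m]: the left-hand side is b < m at 0 and exceeds m
    at m, since exp(m^2) > 1. The value b < m also excludes the root 0, and strict monotonicity
    gives uniqueness. *)
Lemma unique_mul_exp_sqr (b m : R) :
  0 < b < m ->
  exists w, unique (fun x => 0 < x /\ (x + b * exp (x ^ 2)) * exp (x ^ 2) = m) w.
Proof.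
  intros Hb; set (g := fun x => (x + b * exp (x ^ 2)) * exp (x ^ 2)).
  assert (Hg0 : g 0 = b).
  { unfold g; replace (0 ^ 2) with 0 by ring; rewrite exp_0; ring. }
  assert (Hgm : m < g m).
  { unfold g; assert (He : exp 0 < exp (m ^ 2)) by (apply exp_increasing; nra).
    rewrite exp_0 in He; nra. }
  destruct (IVT (fun x => g x - m) 0 m) as [w [Hw Hgw]]; try lra.
  { intros x; apply continuity_pt_filterlim.
    apply (ex_derive_continuous (fun x => g x - m)).
    unfold g; auto_derive; trivial. }
  assert (Hw0 : 0 < w).
  { destruct (Req_dec w 0) as [E|]; [rewrite E in Hgw; lra|lra]. }
  exists w; split; [split; [exact Hw0|unfold g in Hgw; lra]|].
  intros y [Hy Hgy]; unfold g in Hgw.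
  destruct (Rtotal_order w y) as [H|[H|H]]; [|exact H|].
  - assert (Hlt := mul_exp_sqr_lt b w y); lra.
  - assert (Hlt := mul_exp_sqr_lt b y w); lra.
Qed.

(** * Free boundaries proportional to the square root of time *)

Lemma is_derive_mul_sqrt (c alpha t : R) :
  0 < alpha -> 0 < t ->
  is_derive (fun v => 2 * c * sqrt (alpha * v)) t (c * sqrt alpha / sqrt t).
Proof.
  intros Ha Ht; assert (Hat := Rmult_lt_0_compat _ _ Ha Ht).
  assert (Hsa := sqrt_lt_R0 _ Ha); assert (Hst := sqrt_lt_R0 _ Ht).
  auto_derive; [exact Hat|].
  rewrite sqrt_mult by lra.
  field_simplify_eq; [|lra].
  replace (sqrt alpha ^ 2) with alpha; [ring|].
  symmetry; apply pow2_sqrt; lra.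
Qed.

Lemma filterlim_mul_sqrt (c alpha : R) :
  0 < alpha ->
  filterlim (fun v => 2 * c * sqrt (alpha * v)) (at_right 0)
    (locally (2 * c * sqrt (alpha * 0))).
Proof.
  (* The one-sided limit restricts a two-sided one, which holds at 0 because the total [sqrt]
     vanishes on negative arguments. *)
  intros Ha; eapply filterlim_filter_le_1; [apply filter_le_within|].
  apply (continuous_scal_r (2 * c) (fun v => sqrt (alpha * v))).
  apply (continuous_comp (fun v => alpha * v) sqrt).
  - apply (ex_derive_continuous (fun v => alpha * v)); auto_derive; trivial.
  - apply continuity_pt_filterlim, continuity_pt_sqrt; lra.
Qed.

(** * The similarity solution *)

Theorem theorem6 (k rho c ell gamma q0 eps : R)
    (hk : 0 < k) (hrho : 0 < rho) (hc : 0 < c) (hell : 0 < ell)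
    (hgamma : 0 < gamma) (hq0 : 0 < q0) (heps : 0 < eps < 1) :
  let alpha := k / (rho * c) in
  q0 > q0_star gamma eps rho ell k ->
  exists omega : R,
    unique (fun x => 0 < x /\
              G3 gamma eps k q0 alpha x = q0 / (rho * ell * sqrt alpha)) omega /\
    let nu := omega + gamma * k / (2 * q0 * sqrt alpha) * exp (omega ^ 2) in
    let T := fun x t : R =>
      - (q0 * sqrt (PI * alpha) * erf omega / k)
      * (1 - erf (x / (2 * sqrt (alpha * t))) / erf omega) in
    let s := fun t : R => 2 * omega * sqrt (alpha * t) in
    let r := fun t : R => 2 * nu * sqrt (alpha * t) in
    solves_P3 alpha k rho ell eps gamma q0 T s r /\
    (forall x t, 0 < t -> 0 < x < s t -> T x t < 0).
Proof.
  intros alpha Hq.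
  assert (Halpha : 0 < alpha).
  { unfold alpha; apply Rdiv_lt_0_compat; trivial; nra. }
  clearbody alpha; clear c hc.
  assert (Hsa := sqrt_lt_R0 _ Halpha); assert (Hpi := sqrt_PI_pos).
  assert (Hrl : 0 < rho * ell) by nra.
  (* This is the value of [G3] at 0. *)
  set (b := gamma * (1 - eps) * k / (2 * q0 * sqrt alpha)).
  assert (Hb : 0 < b < q0 / (rho * ell * sqrt alpha)).
  { split.
    - unfold b; apply Rdiv_lt_0_compat; [|nra].
      apply Rmult_lt_0_compat; nra.
    - assert (Hqq : gamma * (1 - eps) * rho * ell * k / 2 < q0 ^ 2).
      { apply sqrt_lt_0_alt; rewrite sqrt_pow2 by lra; exact Hq. }
      (* The gap equals (q0^2 - q0_star^2) / (rho ell q0 sqrt alpha), so its sign is that of q0 -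
         q0_star. *)
      apply Rlt_0_minus.
      replace (q0 / (rho * ell * sqrt alpha) - b) with
        ((q0 ^ 2 - gamma * (1 - eps) * rho * ell * k / 2)
         / (rho * ell * (q0 * sqrt alpha))) by (unfold b; field; lra).
      apply Rdiv_lt_0_compat; [lra|].
      apply Rmult_lt_0_compat; [lra|nra]. }
  destruct (unique_mul_exp_sqr b _ Hb) as [omega Homega].
  exists omega; split; [exact Homega|].
  destruct Homega as [[Hw HG] _].
  intros nu T s r.
  (* With this scale, a x / sqrt t is the similarity variable x / (2 sqrt(alpha t)), and T = P
     (erf(a x / sqrt t) - erf omega) for the amplitude [P] below. *)
  set (a := / (2 * sqrt alpha)).
  set (P := q0 * sqrt (PI * alpha) / k).
  assert (Hsat : forall t, 0 < t -> sqrt (alpha * t) = sqrt alpha * sqrt t).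
  { intros t Ht; apply sqrt_mult; lra. }
  assert (HP : P = q0 * sqrt PI * sqrt alpha / k).
  { unfold P; rewrite sqrt_mult by (try apply Rlt_le, PI_RGT_0; lra).
    field; lra. }
  assert (Herf : 0 < erf omega) by (rewrite <- erf_0; now apply erf_lt).
  assert (Hexp := exp_pos (omega ^ 2)).
  assert (HEw : exp (- omega ^ 2) = / exp (omega ^ 2)) by apply exp_Ropp.
  set (e := Add (Cst (- (P * erf omega))) (Mul (Cst P) Erf)).
  assert (HT : forall x t, 0 < t -> T x t = eval a e x t).
  { intros x t Ht; assert (Hst := sqrt_lt_R0 t Ht).
    unfold T; rewrite Hsat by trivial; simpl.
    replace (a * x * / sqrt t) with (x / (2 * (sqrt alpha * sqrt t)))
      by (unfold a; field; lra).
    unfold P; field; lra. }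
  assert (HTx : forall x t, 0 < t ->
    is_derive (fun y => T y t) x (eval a (term_dx a e) x t)).
  { intros x t Ht; apply (is_derive_ext (fun y => eval a e y t)).
    - intros y; symmetry; now apply HT.
    - apply is_derive_eval_dx. }
  assert (HTxx : forall x t, 0 < t ->
    is_derive (fun y => dx T y t) x (eval a (term_dx a (term_dx a e)) x t)).
  { intros x t Ht; apply (is_derive_ext (fun y => eval a (term_dx a e) y t)).
    - intros y; symmetry; now apply is_derive_unique, HTx.
    - apply is_derive_eval_dx. }
  assert (HTt : forall x t, 0 < t ->
    is_derive (fun tau => T x tau) t (eval a (term_dt a e) x t)).
  (* The formula for [T] is available only at positive times, so in t the functions are compared
     near t rather than everywhere. *)
  { intros x t Ht; apply (is_derive_ext_loc (fun tau => eval a e x tau)).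
    - apply (filter_imp (fun v => 0 < v));
        [intros v Hv; symmetry; now apply HT|exact (open_gt 0 t Ht)].
    - now apply is_derive_eval_dt. }
  assert (Hflux : forall x t, 0 < t ->
    dx T x t = q0 / (k * sqrt t) * exp (- (a * x * / sqrt t) ^ 2)).
  { intros x t Ht; assert (Hst := sqrt_lt_R0 t Ht).
    transitivity (eval a (term_dx a e) x t); [now apply is_derive_unique, HTx|].
    cbn [eval term_dx e]; set (E := exp _).
    (* The constants collapse: P * (2 / sqrt PI) * a = q0 / k. *)
    rewrite HP, Rmult_0_l; unfold a; field; lra. }
  assert (Hflux_s : forall t, 0 < t ->
    dx T (s t) t = q0 / (k * sqrt t) * / exp (omega ^ 2)).
  { intros t Ht; assert (Hst := sqrt_lt_R0 t Ht).
    rewrite Hflux by trivial; unfold s; rewrite Hsat by trivial.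
    replace (a * (2 * omega * (sqrt alpha * sqrt t)) * / sqrt t) with omega
      by (unfold a; field; lra).
    now rewrite HEw. }
  assert (Hnu : omega < nu).
  { unfold nu; assert (0 < gamma * k / (2 * q0 * sqrt alpha)); [|nra].
    apply Rdiv_lt_0_compat; nra. }
  split.
  - constructor.
    + intros t Ht; assert (Hst := sqrt_lt_R0 _ (Rmult_lt_0_compat _ _ Halpha Ht)).
      unfold s, r; split; nra.
    + intros t Ht; split; eexists; now apply is_derive_mul_sqrt.
    + intros x t Ht _; assert (Hst := sqrt_lt_R0 t Ht).
      split; [eexists; now apply HTt|].
      split; [eexists; now apply HTx|].
      split; [eexists; now apply HTxx|].
      replace (dt T x t) with (eval a (term_dt a e) x t)
        by (symmetry; now apply is_derive_unique, HTt).
      replace (dx (dx T) x t) with (eval a (term_dx a (term_dx a e)) x t)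
        by (symmetry; now apply is_derive_unique, HTxx).
      cbn [eval term_dx term_dt e].
      (* Both T_t and alpha T_xx are multiples of x w^3 E; their difference carries the factor 4
         alpha a^2 - 1, which this identity annihilates. *)
      assert (Haa : alpha * a ^ 2 = / 4).
      { unfold a; rewrite <- (sqrt_sqrt alpha) at 1 by lra; field; lra. }
      set (E := exp _); set (w := / sqrt t).
      replace (- / sqrt PI * a) with (- (/ sqrt PI * a)) by ring.
      transitivity (P * (/ sqrt PI * a * x * w ^ 3 * E)
                    * (4 * (alpha * a ^ 2) - 1)); [unfold Rdiv; ring|].
      rewrite Haa; field; lra.
    (* The formula for [T] is smooth on the whole half-plane t > 0, so [T] serves as its own
       extension. *)
    + exists T; split.
      * split; [trivial|].
        exists half_plane; split; [apply open_half_plane|].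
        split; [intros x t Ht _; exact Ht|].
        intros n; apply (Ck_ext n _ (eval a e));
          [apply open_half_plane| |apply Ck_eval].
        intros x t Ht; symmetry; now apply HT.
      * intros t Ht; assert (Hst := sqrt_lt_R0 t Ht).
        rewrite Hflux_s by trivial.
        split; [|split; [|split]].
        -- unfold T, s; rewrite Hsat by trivial.
           replace (2 * omega * (sqrt alpha * sqrt t) / (2 * (sqrt alpha * sqrt t)))
             with omega by (field; lra).
           field; lra.
        -- replace (Derive s t) with (omega * sqrt alpha / sqrt t)
             by (symmetry; now apply is_derive_unique, is_derive_mul_sqrt).
           replace (Derive r t) with (nu * sqrt alpha / sqrt t)
             by (symmetry; now apply is_derive_unique, is_derive_mul_sqrt).
           (* The Stefan condition involves the weighted mean of the two boundary coefficients;
              multiplied by exp(omega^2) it is [G3] at [omega], whose value [HG] supplies. *)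
           assert (Hmix : eps * omega + (1 - eps) * nu
                          = omega + b * exp (omega ^ 2)).
           { unfold nu, b; field; lra. }
           transitivity (rho * ell * sqrt alpha / sqrt t
                         * (eps * omega + (1 - eps) * nu)); [|field; lra].
           rewrite Hmix.
           replace (omega + b * exp (omega ^ 2)) with
             (q0 / (rho * ell * sqrt alpha) / exp (omega ^ 2))
             by (rewrite <- HG; field; lra).
           field; lra.
        (* The factor exp(omega^2) in nu - omega cancels the decay of the flux at [s t], leaving
           exactly [gamma]. *)
        -- unfold r, s; rewrite Hsat by trivial; unfold nu; field; lra.
        -- rewrite Hflux by trivial.
           replace (- (a * 0 * / sqrt t) ^ 2) with 0 by ring.
           rewrite exp_0; field; lra.
    + unfold s, r; rewrite Rmult_0_r, sqrt_0; split; ring.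
    + split; now apply filterlim_mul_sqrt.
  - intros x t Ht [Hx0 Hxs]; assert (Hst := sqrt_lt_R0 t Ht).
    assert (Hz : erf (x / (2 * sqrt (alpha * t))) < erf omega).
    { apply erf_lt; unfold s in Hxs; rewrite Hsat in * by trivial.
      apply Rlt_div_l; nra. }
    assert (HP0 : 0 < P).
    { rewrite HP; apply Rdiv_lt_0_compat; trivial.
      repeat apply Rmult_lt_0_compat; trivial. }
    (* In this factored form the sign follows from P > 0 and the monotonicity of [erf]. *)
    replace (T x t) with
      (P * (erf (x / (2 * sqrt (alpha * t))) - erf omega))
      by (unfold T, P; field; lra).
    nra.
Qed.
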